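(* The semantics $\mathit{cf2}$, $\mathit{stg2}$ and $\mathit{tfstg2}$ do not satisfy finitary directionality: for each $\sigma\in\{\mathit{cf2},\mathit{stg2},\mathit{tfstg2}\}$ there is a finitary argumentation framework $\mathcal{F}$ and a set $U\subseteq A_{\mathcal{F}}$ not attacked from outside $U$ such that $\sigma(\mathcal{F}|_U)\neq\{S\cap U: S\in\sigma(\mathcal{F})\}$.
   Context: An argumentation framework (AF) is $\mathcal{F}=(A_{\mathcal{F}},R_{\mathcal{F}})$ with $R_{\mathcal{F}}\subseteq A_{\mathcal{F}}\times A_{\mathcal{F}}$; $a\rightarrow b$ means $(a,b)\in R_{\mathcal{F}}$. $\mathcal{F}$ is finitary if each argument has finitely many attackers. $U$ is not attacked from outside $U$ if there are no $a\notin U$, $b\in U$ with $a\rightarrow b$. A semantics $\sigma$ satisfies finitary directionality if for every finitary $\mathcal{F}$ and every such $U$, $\sigma(\mathcal{F}|_U)=\{S\cap U:S\in\sigma(\mathcal{F})\}$. $\mathcal{F}|_S=(A_{\mathcal{F}}\cap S,R_{\mathcal{F}}\cap(S\times S))$. Conflict-free: no $a,b\in S$ with $a\rightarrow b$; $S^\oplus=S\cup\{x:\exists y\in S,\ y\rightarrow x\}$; naive = $\subseteq$-maximal conflict-free; stage = conflict-free $S$ with no conflict-free $T$ having $S^\oplus\subsetneq T^\oplus$. $\mathrm{SCC}(a)$: set of $b$ with directed attack paths (possibly length 0) from $a$ to $b$ and back; $\mathrm{SCC}(\mathcal{F})$ the set of components. $D_S(X)=\{b\in X:\exists a\in S\setminus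 X,\ a\rightarrow b\}$. $\mathit{cf2}$: $S\in\mathit{cf2}(\mathcal{F})$ iff either $|\mathrm{SCC}(\mathcal{F})|=1$ and $S$ is naive in $\mathcal{F}$, or $|\mathrm{SCC}(\mathcal{F})|\ne1$ and for each $X\in\mathrm{SCC}(\mathcal{F})$, $S\cap X\in\mathit{cf2}(\mathcal{F}|_{X\setminus D_S(X)})$, recursively. For infinite AFs this recursion may not terminate; $S$ counts as a member of $\mathit{cf2}(\mathcal{F})$ only if the tree of recursive calls has no infinite branch (the recursion is well-defined) and the condition holds at all its leaves. $\mathit{stg2}$ is the same with stage in place of naive. $\mathit{tfstg2}$: $C^0_S(a)=\mathrm{SCC}(a)$; $C^{\alpha+1}_S(a)$ = component of $a$ in $\mathcal{F}|_{C^\alpha_S(a)\setminus D_S(C^\alpha_S(a))}$ (empty if $a$ is not there); for limit $\lambda$, $C^\lambda_S(a)$ = component of $a$ in $\mathcal{F}|_{\bigcap_{\alpha<\lambda}C^\alpha_S(a)}$; $\alpha_S(a)$ = least $\alpha$ with $a\notin C^\alpha_S(a)$ or $C^{\alpha+1}_S(a)=C^\alpha_S(a)$; $S\in\mathit{tfstg2}(\mathcal{F})$ iff $S$ is conflict-free and for each $a$, either $a\notin C^{\alpha_S(a)}_S(a)$ or $S\cap C^{\alpha_S(a)}_S(a)$ is a stage extension of $\mathcal{F}|_{C^{\alpha_S(a)}_S(a)}$. *)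

(* Defs.v *)
From Stdlib Require Import List.
Set Implicit Arguments.

Section AFs.
Variable T : Type.

(* An AF: a set of arguments and a relation; the effective attack relation
   is rel restricted to arg x arg, so that R_F ⊆ A_F × A_F. *)
Record AF := mkAF { arg : T -> Prop; rel : T -> T -> Prop }.

Definition att (F : AF) (a b : T) : Prop := arg F a /\ arg F b /\ rel F a b.

Definition restrict (F : AF) (U : T -> Prop) : AF :=
  mkAF (fun x => arg F x /\ U x) (rel F).

Definition subset (X Y : T -> Prop) : Prop := forall x, X x -> Y x.
Definition same (X Y : T -> Prop) : Prop := forall x, X x <-> Y x.

Definition finitary (F : AF) : Prop :=
  forall a, arg F a -> exists l : list T, forall b, att F b a -> In b l.

Definition not_attacked_from_outside (F : AF) (U : T -> Prop) : Prop :=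
  forall a b, ~ U a -> U b -> att F a b -> False.

Definition conflict_free (F : AF) (S : T -> Prop) : Prop :=
  subset S (arg F) /\ forall a b, S a -> S b -> ~ att F a b.

Definition plus (F : AF) (S : T -> Prop) : T -> Prop :=
  fun x => S x \/ exists y, S y /\ att F y x.

Definition naive (F : AF) (S : T -> Prop) : Prop :=
  conflict_free F S /\
  forall S', conflict_free F S' -> subset S S' -> subset S' S.

Definition stage (F : AF) (S : T -> Prop) : Prop :=
  conflict_free F S /\
  ~ (exists S', conflict_free F S' /\
       subset (plus F S) (plus F S') /\ ~ subset (plus F S') (plus F S)).

Inductive reach (F : AF) (a : T) : T -> Prop :=
| reach_refl : arg F a -> reach F a a
| reach_step b c : reach F a b -> att F b c -> reach F a c.

(* SCC(a) in F; empty if a is not an argument of F *)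
Definition scc_of (F : AF) (a : T) : T -> Prop :=
  fun b => reach F a b /\ reach F b a.

Definition is_scc (F : AF) (X : T -> Prop) : Prop :=
  exists a, arg F a /\ same X (scc_of F a).

Definition single_scc (F : AF) : Prop :=
  exists X, is_scc F X /\ forall Y, is_scc F Y -> same Y X.

Definition Dset (F : AF) (S X : T -> Prop) : T -> Prop :=
  fun b => X b /\ exists a, S a /\ ~ X a /\ att F a b.

(* The SCC-recursive scheme; an inductive derivation is exactly a
   recursion tree without infinite branches whose leaves satisfy the base. *)
Inductive scc_rec (base : AF -> (T -> Prop) -> Prop) : AF -> (T -> Prop) -> Prop :=
| scc_rec_base F S :
    subset S (arg F) -> single_scc F -> base F S -> scc_rec base F S
| scc_rec_step F S :
    subset S (arg F) -> ~ single_scc F ->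
    (forall X, is_scc F X ->
       scc_rec base (restrict F (fun x => X x /\ ~ Dset F S X x))
                    (fun x => S x /\ X x)) ->
    scc_rec base F S.

Definition cf2 (F : AF) (S : T -> Prop) : Prop := scc_rec naive F S.
Definition stg2 (F : AF) (S : T -> Prop) : Prop := scc_rec stage F S.

(* tfstg2: the transfinite sequence C^alpha_S(a) is encoded by the
   (Zermelo) tower of its values: the least family containing C^0,
   closed under the successor step and under the limit step applied to
   any subfamily. *)
Definition tf_succ (F : AF) (S : T -> Prop) (a : T) (Y : T -> Prop) : T -> Prop :=
  scc_of (restrict F (fun x => Y x /\ ~ Dset F S Y x)) a.

Definition tf_lim (F : AF) (a : T) (K : (T -> Prop) -> Prop) : T -> Prop :=
  scc_of (restrict F (fun x => forall Y, K Y -> Y x)) a.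

Inductive tower (F : AF) (S : T -> Prop) (a : T) : (T -> Prop) -> Prop :=
| tower0 : tower F S a (scc_of F a)
| towerS Y : tower F S a Y -> tower F S a (tf_succ F S a Y)
| towerL (K : (T -> Prop) -> Prop) :
    (forall Y, K Y -> tower F S a Y) -> tower F S a (tf_lim F a K).

Definition tf_stop (F : AF) (S : T -> Prop) (a : T) (Y : T -> Prop) : Prop :=
  ~ Y a \/ same (tf_succ F S a Y) Y.

(* C^{alpha_S(a)}_S(a): the stage at the least ordinal satisfying the stop
   condition, i.e. the ⊆-largest tower element satisfying it
   (the sequence is ⊆-decreasing). *)
Definition tf_final (F : AF) (S : T -> Prop) (a : T) (Y : T -> Prop) : Prop :=
  tower F S a Y /\ tf_stop F S a Y /\
  forall Y', tower F S a Y' -> tf_stop F S a Y' -> subset Y' Y.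

Definition tfstg2 (F : AF) (S : T -> Prop) : Prop :=
  conflict_free F S /\
  forall a, arg F a ->
    exists Y, tf_final F S a Y /\
      (~ Y a \/ stage (restrict F Y) (fun x => S x /\ Y x)).

End AFs.

Definition semantics := forall T : Type, AF T -> (T -> Prop) -> Prop.

Definition fails_finitary_directionality (sigma : semantics) : Prop :=
  exists (T : Type) (F : AF T) (U : T -> Prop),
    finitary F /\ subset U (arg F) /\ not_attacked_from_outside F U /\
    ~ (forall E : T -> Prop,
         sigma T (restrict F U) E <->
         exists S, sigma T F S /\ forall x, E x <-> S x /\ U x).

(* Main.v *)
From Stdlib Require Import List Arith Lia Classical.
Require Import Defs.

(** Taking [U] empty, it is enough to find finitary frameworks without any
    extension, since the empty framework has the empty extension.

    For cf2 and stg2: in the framework [a_n -> b_n -> a_(n+1)],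
    [b_(n+1) -> b_n], the argument [a_n] is unattacked in the tail from [n] on,
    so it is accepted and deletes [b_n]; what remains of the other component is
    the tail from [n+1] on, and the recursion never ends.

    For tfstg2: the framework consists of infinitely many infinite components
    (layers), layer [n+1] attacking layer [n].  The arguments [M n k] of a layer
    exclude each other, and each of them is alone in attacking the
    self-attacking [W n k], so that accepting no [M n k] at all is never optimal:
    layer [n] accepts exactly one [M n (k n)].  If [M (n+1) K] is accepted, it
    deletes [Q n K]; this makes [P n K] unattacked, and deletions propagate
    downwards so that all [P n j] with [j <= K] are accepted and [M n j] is
    rejected.  Hence [k n > k (n+1)] for all [n], which is impossible. *)

Set Implicit Arguments.
Unset Strict Implicit.

(** * General facts *)

Section General.
Variable T : Type.
Implicit Types (F : AF T) (E X Y Z : T -> Prop).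

(** * Reachability and strongly connected components *)

Lemma reach_trans F a b c : reach F a b -> reach F b c -> reach F a c.
Proof.
  intros Hab Hbc; induction Hbc as [|b' c _ IH Hatt]; trivial.
  exact (reach_step IH Hatt).
Qed.

Lemma reach_arg F a b : reach F a b -> arg F a.
Proof. now induction 1. Qed.

Lemma reach_arg_r F a b : reach F a b -> arg F b.
Proof. destruct 1 as [|b c _ Hatt]; trivial. exact (proj1 (proj2 Hatt)). Qed.

Lemma att_reach F a b : att F a b -> reach F a b.
Proof.
  intros Hatt. exact (reach_step (reach_refl _ _ (proj1 Hatt)) Hatt).
Qed.

Lemma reach_restrict_mono F X Y a b :
  subset X Y -> reach (restrict F X) a b -> reach (restrict F Y) a b.
Proof.
  intros HXY; induction 1 as [[Ha HX]|b c _ IH [[? ?] [[? ?] ?]]].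
  - apply reach_refl; split; auto.
  - refine (reach_step IH _). repeat split; simpl; auto.
Qed.

Lemma reach_restrict F X a b : reach (restrict F X) a b -> reach F a b.
Proof.
  induction 1 as [[Ha HX]|b c _ IH [[? ?] [[? ?] ?]]].
  - now apply reach_refl.
  - refine (reach_step IH _). repeat split; auto.
Qed.

Lemma reach_invariant F (I : T -> Prop) a b :
  I a -> (forall x y, I x -> att F x y -> I y) -> reach F a b -> I b.
Proof. intros Ha HI; induction 1; eauto. Qed.

Lemma reach_unattacked F a b :
  (forall x, ~ att F x b) -> reach F a b -> a = b.
Proof.
  intros Hb Hr; destruct Hr as [|b c _ Hatt]; trivial. now destruct (Hb b).
Qed.

Lemma scc_of_self F a : arg F a -> scc_of F a a.
Proof. intros Ha; split; now apply reach_refl. Qed.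

Lemma scc_is_scc F a : arg F a -> is_scc F (scc_of F a).
Proof. intros Ha; exists a; split; [trivial|intro; tauto]. Qed.

(** * Reduction to frameworks without extensions *)

Lemma fails_of_no_extension (sigma : semantics) F :
  finitary F ->
  (forall E, ~ sigma T F E) ->
  sigma T (restrict F (fun _ => False)) (fun _ => False) ->
  fails_finitary_directionality sigma.
Proof.
  intros Hfin Hno Hempty.
  exists T, F, (fun _ => False); repeat split; trivial.
  - now intros x [].
  - now intros a b _ [].
  - intros Hdir. apply Hdir in Hempty as [E [HE _]]. exact (Hno E HE).
Qed.

(** The empty framework has zero components, so the recursive clause applies, vacuously. *)
Lemma scc_rec_empty base F :
  scc_rec base (restrict F (fun _ => False)) (fun _ => False).
Proof.
  apply scc_rec_step.
  - now intros x [].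
  - now intros [X [[a [[_ []] _]] _]].
  - now intros X [a [[_ []] _]].
Qed.

Lemma tfstg2_empty F : tfstg2 (restrict F (fun _ => False)) (fun _ => False).
Proof.
  split; [split|].
  - now intros x [].
  - now intros a b [].
  - now intros a [_ []].
Qed.

Lemma singleton_conflict_free F a :
  arg F a -> ~ rel F a a -> conflict_free F (fun x => x = a).
Proof.
  intros Ha Haa; split.
  - now intros x ->.
  - now intros x y -> -> [_ [_ H]].
Qed.

(** The one property of the base semantics that the ladder argument uses; it lets [naive] and
    [stage] be treated at once. *)
Definition accepts_singleton (base : AF T -> (T -> Prop) -> Prop) :=
  forall F E a, (forall x, arg F x <-> x = a) -> ~ rel F a a -> base F E -> E a.

Lemma naive_accepts_singleton : accepts_singleton (@naive T).
Proof.
  intros F E a Ha Haa [[HE _] Hmax].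
  apply (Hmax (fun x => x = a)); trivial.
  - apply singleton_conflict_free; trivial. now apply Ha.
  - intros x Hx. now apply Ha, HE.
Qed.

Lemma stage_accepts_singleton : accepts_singleton (@stage T).
Proof.
  intros F E a Ha Haa [[HE _] Hmax].
  apply NNPP; intros HEa; apply Hmax.
  assert (HE0 : forall x, ~ E x).
  { intros x Hx. apply HEa. now rewrite <- (proj1 (Ha x) (HE x Hx)). }
  exists (fun x => x = a); repeat split.
  1-2: apply singleton_conflict_free; trivial; now apply Ha.
  - intros x [Hx|[y [Hy _]]]; [now apply HE0 in Hx|now apply HE0 in Hy].
  - intros Hsub. destruct (Hsub a) as [Hx|[y [Hy _]]].
    + now left.
    + now apply HE0 in Hx.
    + now apply HE0 in Hy.
Qed.

Lemma scc_rec_singleton base F E a :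
  accepts_singleton base -> (forall x, arg F x <-> x = a) -> ~ rel F a a ->
  scc_rec base F E -> E a.
Proof.
  intros Hbase Ha Haa HE; destruct HE as [F E _ _ HE|F E _ Hns _].
  - exact (Hbase F E a Ha Haa HE).
  - exfalso; apply Hns.
    exists (scc_of F a); split; [now apply scc_is_scc, Ha|].
    intros Y [b [Hb HY]] x. apply Ha in Hb as ->. apply HY.
Qed.

(** * The transfinite sequence and its fixed points *)

Lemma tower_subset F E a Y : tower F E a Y -> subset Y (scc_of F a).
Proof.
  (* Each constructor yields a component of [a] in [F] or in a restriction of [F], so a case
     distinction suffices. *)
  intros HY x Hx; destruct HY as [|Y HY|K HK]; trivial;
    destruct Hx as [H1 H2]; split; eapply reach_restrict; eassumption.
Qed.

(* A strongly connected [Z] that [E] does not attack from outside survives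
   every step of the transfinite sequence. *)
Lemma tower_superset F E Z a Y :
  (forall z, Z z -> reach (restrict F Z) a z /\ reach (restrict F Z) z a) ->
  (forall x z, E x -> ~ Z x -> Z z -> ~ att F x z) ->
  tower F E a Y -> subset Z Y.
Proof.
  intros Hconn Hatt; induction 1 as [|Y _ IH|K _ IH]; intros z Hz;
    destruct (Hconn z Hz) as [H1 H2].
  - split; eapply reach_restrict; eassumption.
  - assert (HZ : subset Z (fun x => Y x /\ ~ Dset F E Y x)).
    { intros y Hy; split; [now apply IH|].
      intros [_ [x [HEx [HYx Hxy]]]].
      apply (Hatt x y); auto. }
    split; eapply reach_restrict_mono; eassumption.
  - assert (HZ : subset Z (fun x => forall Y, K Y -> Y x)).
    { intros y Hy Y HY. now apply (IH Y). }
    split; eapply reach_restrict_mono; eassumption.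
Qed.

Lemma tower_unattacked F E a Y :
  arg F a -> (forall x, E x -> ~ att F x a) -> tower F E a Y -> Y a.
Proof.
  intros Ha Hatt HY.
  apply (@tower_superset F E (fun x => x = a) a Y); trivial.
  - intros z ->; split; apply reach_refl; now split.
  - intros x z HEx _ ->; auto.
Qed.

(** If [x] were outside [Y], then [y] would lie in [Dset F E Y] and be lost in the next step. *)
Lemma fixpoint_not_attacked F E a Y x y :
  same (tf_succ F E a Y) Y -> E x -> Y y -> att F x y -> Y x.
Proof.
  intros Hfix HEx HYy Hxy. apply NNPP; intros HYx.
  apply Hfix in HYy as [Hr _]. apply reach_arg_r in Hr as [_ [HYy HD]].
  apply HD; split; trivial. now exists x.
Qed.

Lemma fixpoint_reach F E a Y y :
  same (tf_succ F E a Y) Y -> Y y ->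
  reach (restrict F Y) a y /\ reach (restrict F Y) y a.
Proof.
  intros Hfix Hy. apply Hfix in Hy as [H1 H2].
  split; eapply reach_restrict_mono; try eassumption; now intros x [].
Qed.

(** Since [a] survives every step, the alternatives with [~ Y a] drop out both of the stop condition
    and of the acceptance condition. *)
Lemma tfstg2_unattacked F E a :
  tfstg2 F E -> arg F a -> (forall x, E x -> ~ att F x a) ->
  exists Y, tower F E a Y /\ same (tf_succ F E a Y) Y /\ Y a /\
    stage (restrict F Y) (fun x => E x /\ Y x).
Proof.
  intros [_ HE] Ha Hatt.
  destruct (HE a Ha) as [Y [[HY [Hstop _]] Hstage]].
  pose proof (tower_unattacked Ha Hatt HY) as HYa.
  exists Y; destruct Hstop, Hstage; tauto.
Qed.

End General.

(** * Endless recursion *)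

Inductive ladder := LA (n : nat) | LB (n : nat).

Definition rung (x : ladder) := match x with LA n | LB n => n end.

Inductive ladder_att : ladder -> ladder -> Prop :=
| att_AB n : ladder_att (LA n) (LB n)
| att_BA n : ladder_att (LB n) (LA (S n))
| att_BB n : ladder_att (LB (S n)) (LB n).

Definition ladder_AF : AF ladder := mkAF (fun _ => True) ladder_att.

Lemma ladder_finitary : finitary ladder_AF.
Proof.
  intros a _; exists (LA (rung a) :: LB (S (rung a)) :: LB (pred (rung a)) :: nil).
  intros b [_ [_ H]]; destruct H; simpl; auto.
Qed.

(** * The tail of the ladder from rung [n] on *)

Section Tail.
(** The tail is given by its relation and its arguments up to equivalence, since the recursion
    produces it as an iterated [restrict]. *)
Variables (F : AF ladder) (n : nat).
Hypothesis Frel : rel F = ladder_att.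
Hypothesis Farg : forall x, arg F x <-> n <= rung x.

Let attI x y : n <= rung x -> n <= rung y -> ladder_att x y -> att F x y.
Proof. intros Hx Hy H; repeat split; [now apply Farg..|now rewrite Frel]. Qed.

Let attE x y : att F x y -> n <= rung x /\ n <= rung y /\ ladder_att x y.
Proof. intros [Hx [Hy H]]. rewrite Farg in Hx, Hy. now rewrite Frel in H. Qed.

Lemma tail_LA_unattacked x : ~ att F x (LA n).
Proof. intros H; apply attE in H as [H1 [_ H]]; inversion H; subst; simpl in *; lia. Qed.

Lemma tail_scc_LA x : scc_of F (LA n) x <-> x = LA n.
Proof.
  split.
  - intros [_ H]. exact (reach_unattacked (@tail_LA_unattacked) H).
  - intros ->. now apply scc_of_self, Farg.
Qed.

Lemma tail_reach_up k : reach F (LB n) (LB (n + k)).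
Proof.
  induction k as [|k IH].
  - rewrite Nat.add_0_r. now apply reach_refl, Farg.
  - rewrite Nat.add_succ_r.
    refine (reach_step (reach_step IH _) (attI _ _ (att_AB _))); simpl; try lia.
    apply attI; simpl; try lia. constructor.
Qed.

Lemma tail_reach_down k : reach F (LB (n + k)) (LB n).
Proof.
  induction k as [|k IH].
  - rewrite Nat.add_0_r. now apply reach_refl, Farg.
  - rewrite Nat.add_succ_r.
    refine (reach_trans (att_reach (attI _ _ (att_BB _))) IH); simpl; lia.
Qed.

(** The [LB] are linked downwards directly and upwards through [LA (S i)], which puts every later
    [LA] on a cycle; [LA n] is unattacked, hence on none. *)
Lemma tail_scc_LB x : scc_of F (LB n) x <-> n <= rung x /\ x <> LA n.
Proof.
  split.
  - intros [H1 H2]; split.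
    + apply Farg. exact (reach_arg H2).
    + intros ->. now apply reach_unattacked in H1; [|apply tail_LA_unattacked].
  - assert (HB : forall i, n <= i -> reach F (LB n) (LB i) /\ reach F (LB i) (LB n)).
    { intros i Hi. replace i with (n + (i - n)) by lia.
      split; [apply tail_reach_up|apply tail_reach_down]. }
    intros [Hx Hne]; destruct x as [i|i]; simpl in Hx; [|now apply HB].
    assert (i <> n) by congruence. destruct i as [|i]; [lia|].
    split.
    + refine (reach_step (proj1 (HB i _)) (attI _ _ (att_BA _))); simpl; lia.
    + refine (reach_trans (att_reach (attI _ _ (att_AB _))) (proj2 (HB _ _)));
        simpl; lia.
Qed.

Lemma tail_not_single : ~ single_scc F.
Proof.
  intros [X [_ HX]].
  assert (HA : same (scc_of F (LA n)) X) by now apply HX, scc_is_scc, Farg.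
  assert (HB : same (scc_of F (LB n)) X) by now apply HX, scc_is_scc, Farg.
  assert (H : scc_of F (LB n) (LA n)) by now apply HB, HA, tail_scc_LA.
  now apply tail_scc_LB in H as [_ H].
Qed.

Lemma tail_residual_LA E x :
  arg (restrict F (fun x => scc_of F (LA n) x /\ ~ Dset F E (scc_of F (LA n)) x)) x
  <-> x = LA n.
Proof.
  simpl; rewrite tail_scc_LA; split; [tauto|]. intros ->.
  split; [now apply Farg|split; trivial].
  intros [_ [a [_ [_ H]]]]. exact (tail_LA_unattacked H).
Qed.

(** [LA n] is the only argument outside the component and attacks only [LB n], so exactly [LB n] is
    deleted. *)
Lemma tail_residual_LB E x :
  E (LA n) ->
  arg (restrict F (fun x => scc_of F (LB n) x /\ ~ Dset F E (scc_of F (LB n)) x)) x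
  <-> S n <= rung x.
Proof.
  intros HEa; simpl; rewrite tail_scc_LB, Farg; split.
  - intros [Hx [[_ Hne] HD]].
    assert (rung x <> n); [|lia]. intros Hxn.
    destruct x as [i|i]; simpl in Hxn; subst i; [now apply Hne|].
    apply HD; split; [now apply tail_scc_LB|].
    exists (LA n); split; trivial; split.
    + rewrite tail_scc_LB; tauto.
    + now apply attI; simpl; try constructor.
  - intros Hx; repeat split; try lia.
    + intros ->; simpl in Hx; lia.
    + intros [_ [a [Ha [Hna Hatt]]]]. apply Hna, tail_scc_LB.
      apply attE in Hatt as [Han [_ Hatt]]; split; trivial.
      intros ->; inversion Hatt; subst; simpl in Hx; lia.
Qed.

End Tail.

(** Induction on the derivation: one for the tail from [n] contains one for the tail from [S n], so
    a well-founded derivation cannot exist. *)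
Lemma tail_no_scc_rec base F E :
  accepts_singleton base -> scc_rec base F E ->
  forall n, rel F = ladder_att -> (forall x, arg F x <-> n <= rung x) -> False.
Proof.
  intros Hbase; induction 1 as [F E HE Hs _|F E HE _ Hrec IH]; intros n Hrel Harg.
  - exact (tail_not_single Hrel Harg Hs).
  - assert (HEa : E (LA n)).
    { assert (HX : is_scc F (scc_of F (LA n))) by now apply scc_is_scc, Harg.
      specialize (Hrec _ HX).
      apply (@scc_rec_singleton _ base _ _ (LA n) Hbase) in Hrec as [H _]; trivial.
      - intros x. now apply tail_residual_LA.
      - simpl; rewrite Hrel; intros H; inversion H. }
    apply (IH (scc_of F (LB n))) with (n := S n); trivial.
    + now apply scc_is_scc, Harg.
    + intros x. now apply tail_residual_LB.
Qed.

Lemma ladder_no_scc_rec base E :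
  accepts_singleton base -> ~ scc_rec base ladder_AF E.
Proof.
  intros Hbase HE. apply (tail_no_scc_rec Hbase HE) with (n := 0); trivial.
  simpl; split; auto with arith.
Qed.

(** * Infinite descent through layers *)

(* The first parameter is the layer, the second the index within the layer. *)
Inductive node :=
  | P (n j : nat) | Q (n j : nat) | M (n j : nat) | W (n j : nat).

Definition layer x := match x with P n _ | Q n _ | M n _ | W n _ => n end.
Definition index x := match x with P _ j | Q _ j | M _ j | W _ j => j end.

(** [att_QP] and [att_PQ] form the descending chain along which deletions propagate, and [att_cut]
    is the only link between layers. [att_MQ] and [att_WQ] serve strong connectivity; the shift in
    [att_MQ] keeps [M n c] compatible with each [Q n j], [c <= j]. *)
Inductive layer_att : node -> node -> Prop :=
| att_QP n j : layer_att (Q n j) (P n j)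
| att_PQ n j : layer_att (P n (S j)) (Q n j)
| att_PM n j : layer_att (P n j) (M n j)
| att_MM n i j : i < j -> layer_att (M n i) (M n j)
| att_MQ n j : layer_att (M n (S j)) (Q n j)
| att_MW n j : layer_att (M n j) (W n j)
| att_WW n j : layer_att (W n j) (W n j)
| att_WQ n j : layer_att (W n j) (Q n j)
| att_cut n j : layer_att (M (S n) j) (Q n j).

Definition layered_AF : AF node := mkAF (fun _ => True) layer_att.

Lemma layered_att x y : att layered_AF x y <-> layer_att x y.
Proof. unfold att; simpl; tauto. Qed.

Lemma layered_restrict_att Y x y :
  att (restrict layered_AF Y) x y <-> Y x /\ Y y /\ layer_att x y.
Proof. unfold att; simpl; tauto. Qed.

Lemma layered_finitary : finitary layered_AF.
Proof.
  intros a _; destruct a as [n j|n j|n j|n j].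
  - exists (Q n j :: nil). intros b H; apply layered_att in H.
    inversion H; simpl; auto.
  - exists (P n (S j) :: M n (S j) :: W n j :: M (S n) j :: nil).
    intros b H; apply layered_att in H. inversion H; simpl; auto.
  - exists (P n j :: map (M n) (seq 0 j)). intros b H; apply layered_att in H.
    inversion H; subst; simpl; auto. right. apply in_map, in_seq; lia.
  - exists (M n j :: W n j :: nil). intros b H; apply layered_att in H.
    inversion H; simpl; auto.
Qed.

Lemma reach_layer x y : reach layered_AF x y -> layer y <= layer x.
Proof.
  apply (@reach_invariant _ _ (fun y => layer y <= layer x)); [lia|].
  intros a b Ha H; apply layered_att in H; destruct H; simpl in *; lia.
Qed.

Lemma tower_layer E a Y y : tower layered_AF E a Y -> Y y -> layer y = layer a.
Proof.
  intros HY Hy. apply (tower_subset HY) in Hy as [H1 H2].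
  apply reach_layer in H1, H2; lia.
Qed.

(** * Strong connectivity of a layer above a cut *)

Definition above n c x := layer x = n /\ c <= index x.

(** From [M n c] one jumps to any [M n j], then to the [Q], [P] and [W]; the chain of [P] and [Q]
    leads back down to [P n c] and [M n c], never using an index below [c]. *)
Lemma above_connected n c z :
  above n c z -> reach (restrict layered_AF (above n c)) (M n c) z /\
                 reach (restrict layered_AF (above n c)) z (M n c).
Proof.
  set (G := restrict layered_AF (above n c)).
  assert (edge : forall x y, above n c x -> above n c y -> layer_att x y ->
                 reach G x y).
  { intros x y Hx Hy H. now apply att_reach, layered_restrict_att. }
  assert (upM : forall j, c <= j -> reach G (M n c) (M n j)).
  { intros j Hj. destruct (Nat.eq_dec c j) as [<-|Hne].
    - apply reach_refl; repeat split; auto.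
    - apply edge; try (split; simpl; auto; lia). constructor; lia. }
  assert (upQ : forall j, c <= j -> reach G (M n c) (Q n j)).
  { intros j Hj. apply reach_trans with (M n (S j)); [apply upM; lia|].
    apply edge; try (split; simpl; auto; lia). constructor. }
  assert (downP : forall k, reach G (P n (c + k)) (M n c)).
  { induction k as [|k IH].
    - rewrite Nat.add_0_r. apply edge; try (split; simpl; auto; lia). constructor.
    - rewrite Nat.add_succ_r. apply reach_trans with (Q n (c + k)).
      + apply edge; try (split; simpl; auto; lia). constructor.
      + apply reach_trans with (P n (c + k)); trivial.
        apply edge; try (split; simpl; auto; lia). constructor. }
  assert (downQ : forall j, c <= j -> reach G (Q n j) (M n c)).
  { intros j Hj. apply reach_trans with (P n j).
    - apply edge; try (split; simpl; auto; lia). constructor.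
    - replace j with (c + (j - c)) by lia. apply downP. }
  intros [Hl Hi]; destruct z as [? j|? j|? j|? j]; simpl in Hl, Hi; subst; split; auto.
  - apply reach_trans with (Q n j); auto.
    apply edge; try (split; simpl; auto; lia). constructor.
  - replace j with (c + (j - c)) by lia. apply downP.
  - apply reach_trans with (Q n j); auto. apply reach_trans with (M n (S j)).
    + apply edge; try (split; simpl; auto; lia). constructor; lia.
    + apply edge; try (split; simpl; auto; lia). constructor.
  - apply reach_trans with (M n j); auto.
    apply edge; try (split; simpl; auto; lia). constructor.
  - apply reach_trans with (Q n j); auto.
    apply edge; try (split; simpl; auto; lia). constructor.
Qed.

(** * Consequences of a hypothetical extension [E] *)

Section Extension.
Variable E : node -> Prop.
Hypothesis HE : tfstg2 layered_AF E.

Lemma ext_conflict_free x y : E x -> E y -> ~ layer_att x y.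
Proof.
  intros Hx Hy H. apply (proj2 (proj1 HE) x y); trivial. now apply layered_att.
Qed.

Lemma ext_M_unique n i j : E (M n i) -> E (M n j) -> i = j.
Proof.
  intros Hi Hj. destruct (Nat.lt_total i j) as [H|[H|H]]; trivial; exfalso.
  - now apply (ext_conflict_free Hi Hj); constructor.
  - now apply (ext_conflict_free Hj Hi); constructor.
Qed.

Lemma ext_no_W n j : ~ E (W n j).
Proof. intros H. apply (ext_conflict_free H H). constructor. Qed.

(* Above the cut, the set [{M n c} ∪ {Q n j : j >= c}] has every argument
   except the [W n j] with [j <> c] in its range, while a set without any [M n j]
   has no [W n j] in its range. *)
Lemma ext_M_above n c :
  (forall K, E (M (S n) K) -> K < c) ->
  (c = 0 \/ exists K, c = S K /\ E (M (S n) K)) ->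
  exists k, E (M n k).
Proof.
  intros Hlow Hcut. apply NNPP; intros Hno.
  assert (HM : forall k, ~ E (M n k)) by (intros k H; apply Hno; now exists k).
  (* Within the layer only an [M] attacks a higher index, and [E] has none there; from layer [S n],
     accepted arguments hit only some [Q n K] with [K < c]. *)
  assert (Hout : forall x z, E x -> ~ above n c x -> above n c z ->
                   ~ att layered_AF x z).
  { intros x z Hx Hax [Hl Hi] H. apply layered_att in H.
    destruct H; simpl in Hl, Hi; subst; try now apply (HM _ Hx).
    - apply Hax; split; simpl; lia.
    - apply Hax; split; simpl; lia.
    - apply Hax; split; simpl; lia.
    - exact (ext_no_W Hx).
    - exact (ext_no_W Hx).
    - apply Hlow in Hx; lia. }
  destruct HE as [_ HEa].
  destruct (HEa (M n c) I) as [Y [[HY [Hstop _]] Hstage]].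
  assert (Hsup : subset (above n c) Y).
  { exact (tower_superset (@above_connected n c) Hout HY). }
  assert (HYc : Y (M n c)) by (apply Hsup; split; simpl; auto).
  destruct Hstop as [Hstop|Hfix]; [tauto|].
  destruct Hstage as [Hstage|[_ Hmax]]; [tauto|].
  assert (Hsub : subset Y (above n c)).
  { intros y Hy. destruct (fixpoint_reach Hfix Hy) as [Hr _].
    revert Hr. apply reach_invariant; [split; simpl; auto|].
    intros x z [Hxl Hxi] H. apply (@layered_restrict_att Y) in H as [_ [Hz H]].
    pose proof (tower_layer HY Hz) as Hzl. simpl in Hzl. split; trivial.
    (* Inside the layer, the only way from [above n c] to an index below [c] is into [Q n (c - 1)],
       which the accepted [M (S n) (c - 1)] has deleted. *)
    assert (Hcz : forall j, z = Q n j -> c <= S j -> c <= j).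
    { intros j -> Hj. destruct (Nat.eq_dec c (S j)) as [->|]; [|lia].
      destruct Hcut as [|[K [HK HEK]]]; [lia|].
      injection HK as <-.
      assert (HYK : Y (M (S n) j)).
      { apply (fixpoint_not_attacked Hfix HEK Hz). apply layered_att; constructor. }
      apply (tower_layer HY) in HYK; simpl in HYK; lia. }
    destruct H; simpl in *; subst; auto; lia. }
  apply Hmax.
  exists (fun x => x = M n c \/ exists j, c <= j /\ x = Q n j); repeat split.
  - destruct H as [->|[j [Hj ->]]]; apply Hsup; split; simpl; auto.
  - intros x y Hx Hy H. apply (@layered_restrict_att Y) in H as [_ [_ H]].
    destruct Hx as [->|[i [Hi ->]]], Hy as [Hy|[j [Hj Hy]]]; subst;
      inversion H; subst; lia.
  - assert (cover : forall x, Y x -> (forall j, x <> W n j) ->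
      plus (restrict layered_AF Y) (fun x => x = M n c \/ exists j, c <= j /\ x = Q n j) x).
    { intros x Hx HW. destruct (Hsub x Hx) as [Hl Hi].
      destruct x as [? j|? j|? j|? j]; simpl in Hl, Hi; subst.
      - right; exists (Q n j); split; [right; now exists j|].
        apply layered_restrict_att; repeat split; trivial; [|constructor].
        apply Hsup; split; simpl; auto.
      - left; right; now exists j.
      - destruct (Nat.eq_dec c j) as [<-|]; [now left; left|].
        right; exists (M n c); split; [now left|].
        apply layered_restrict_att; repeat split; trivial; constructor; lia.
      - now destruct (HW j). }
    intros x [[Hx HYx]|[y [[Hy HYy] H]]].
    + apply cover; trivial. intros j ->. exact (ext_no_W Hx).
    + apply (@layered_restrict_att Y) in H as [_ [HYx H]].
      apply cover; trivial. intros j ->. inversion H; subst.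
      * now apply (HM j).
      * exact (ext_no_W Hy).
  (* [W n c] separates the ranges: its only attackers are [M n c] and itself, neither of which is in
     [E]. *)
  - intros H. destruct (H (W n c)) as [[Hx _]|[y [[Hy _] Hatt]]].
    + right; exists (M n c); split; [now left|].
      apply layered_restrict_att; repeat split; trivial; [|constructor].
      apply Hsup; split; simpl; auto.
    + exact (ext_no_W Hx).
    + apply (@layered_restrict_att Y) in Hatt as [_ [_ Hatt]]. inversion Hatt; subst.
      * now apply (HM c).
      * exact (ext_no_W Hy).
Qed.

(** The cut is just above the unique accepted [M (S n) K], or at 0 if there is none. *)
Lemma ext_M_exists n : exists k, E (M n k).
Proof.
  destruct (classic (exists K, E (M (S n) K))) as [[K HK]|Hno].
  - apply ext_M_above with (c := S K).
    + intros K' HK'. rewrite (ext_M_unique HK' HK); lia.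
    + right; now exists K.
  - apply ext_M_above with (c := 0); auto.
    intros K HK. destruct Hno; now exists K.
Qed.

(** Downward induction from [j = K]. An accepted argument attacks [Q n j], so [Q n j] is not in [E]
    and [P n j] survives; it ends up alone in its component and is accepted. *)
Lemma ext_P_below n K d j : E (M (S n) K) -> j + d = K -> E (P n j).
Proof.
  intros HK; revert j; induction d as [d IH] using lt_wf_ind; intros j Hj.
  assert (IHP : forall i, j < i <= K -> E (P n i)).
  { intros i Hi. apply (IH (K - i)); lia. }
  assert (Hatt : exists x, E x /\ layer_att x (Q n j)).
  { destruct (Nat.eq_dec j K) as [->|Hne].
    - exists (M (S n) K); split; trivial; constructor.
    - exists (P n (S j)); split; [apply IHP; lia|constructor]. }
  destruct (@tfstg2_unattacked _ _ _ (P n j) HE I) as [Y [HY [Hfix [HYj Hstage]]]].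
  { intros x Hx H. apply layered_att in H. inversion H; subst.
    destruct Hatt as [y [Hy Hyq]]. exact (ext_conflict_free Hy Hx Hyq). }
  (* Descending from [Q n K], deleted by [M (S n) K]: if [Q n i] were in [Y], so would be its
     accepted attacker [P n (S i)], which is unattacked in [Y] once [Q n (S i)] is gone and hence
     unreachable from [P n j]. *)
  assert (HQ : forall e i, i + e = K -> j <= i -> ~ Y (Q n i)).
  { induction e as [|e IHe]; intros i Hi Hji HYq.
    - assert (HYK : Y (M (S n) K)).
      { apply (fixpoint_not_attacked Hfix HK HYq). apply layered_att.
        replace i with K by lia; constructor. }
      apply (tower_layer HY) in HYK; simpl in HYK; lia.
    - assert (HYp : Y (P n (S i))).
      { apply (fun HEp => fixpoint_not_attacked (x := P n (S i)) Hfix HEp HYq).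
        - apply IHP; lia.
        - apply layered_att; constructor. }
      destruct (fixpoint_reach Hfix HYp) as [Hr _].
      apply reach_unattacked in Hr; [injection Hr; lia|].
      intros x H. apply (@layered_restrict_att Y) in H as [Hx [_ H]].
      inversion H; subst. apply (IHe (S i)); trivial; lia. }
  refine (proj1 (@stage_accepts_singleton _ (restrict layered_AF Y) _ (P n j) _ _ Hstage)).
  - intros x; split; [|intros ->; now split].
    intros [_ Hx]. destruct (fixpoint_reach Hfix Hx) as [_ Hr].
    apply reach_unattacked in Hr; trivial.
    intros y H. apply (@layered_restrict_att Y) in H as [Hy [_ H]].
    inversion H; subst. apply (HQ d j); trivial; lia.
  - intros H; inversion H.
Qed.

Lemma ext_M_decreasing n k K : E (M n k) -> E (M (S n) K) -> K < k.
Proof.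
  intros Hk HK. destruct (Nat.lt_ge_cases K k) as [|Hle]; trivial; exfalso.
  assert (HP : E (P n k)) by (apply (@ext_P_below n K (K - k)); trivial; lia).
  apply (ext_conflict_free HP Hk). constructor.
Qed.

(** Infinite descent on [k] for all layers at once: layer [S n] accepts some [M] of smaller
    index. *)
Lemma ext_no_M n k : ~ E (M n k).
Proof.
  revert n; induction k as [k IH] using lt_wf_ind; intros n Hk.
  destruct (ext_M_exists (S n)) as [K HK].
  exact (IH K (ext_M_decreasing Hk HK) (S n) HK).
Qed.

End Extension.

Lemma layered_no_tfstg2 E : ~ tfstg2 layered_AF E.
Proof.
  intros HE. destruct (ext_M_exists HE 0) as [k Hk]. exact (ext_no_M HE Hk).
Qed.

Theorem theorem3 :
  fails_finitary_directionality (@cf2) /\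
  fails_finitary_directionality (@stg2) /\
  fails_finitary_directionality (@tfstg2).
Proof.
  split; [|split].
  - apply fails_of_no_extension with (F := ladder_AF).
    + exact ladder_finitary.
    + intros E. apply ladder_no_scc_rec, naive_accepts_singleton.
    + apply scc_rec_empty.
  - apply fails_of_no_extension with (F := ladder_AF).
    + exact ladder_finitary.
    + intros E. apply ladder_no_scc_rec, stage_accepts_singleton.
    + apply scc_rec_empty.
  - apply fails_of_no_extension with (F := layered_AF).
    + exact layered_finitary.
    + exact layered_no_tfstg2.
    + apply tfstg2_empty.
Qed.
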